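(* Let $R$ be a tolerance induced by an irredundant covering of $U$. Then the algebra $\mathbb{RS}=(\mathit{RS},\vee,\wedge,{\sim},(\emptyset,\emptyset),(U,U))$ is a quasi-Nelson algebra, where $\vee$ and $\wedge$ are the join and meet in the ordered set $\mathit{RS}$ and ${\sim}(A,B)=(B^c,A^c)$.
   Context: A tolerance on $U$ is a reflexive and symmetric binary relation $R$ on $U$; $R(x)=\{y\in U\mid x\,R\,y\}$. For $X\subseteq U$, $X^{\blacktriangledown}=\{x\in U\mid R(x)\subseteq X\}$, $X^{\blacktriangle}=\{x\in U\mid R(x)\cap X\neq\emptyset\}$, and $X^c=U\setminus X$. $\mathit{RS}=\{(X^{\blacktriangledown},X^{\blacktriangle})\mid X\subseteq U\}$ is ordered coordinatewise by inclusion. A covering of $U$ is a collection $\mathcal{H}$ of nonempty subsets of $U$ with $\bigcup\mathcal{H}=U$; it is irredundant if $\mathcal{H}\setminus\{X\}$ is not a covering of $U$ for any $X\in\mathcal{H}$. The tolerance induced by a covering $\mathcal{H}$ is $R_{\mathcal{H}}=\bigcup\{X\times X\mid X\in\mathcal{H}\}$. A Kleene algebra is a structure $(A,\vee,\wedge,{\sim},0,1)$ such that $(A,\vee,\wedge,0,1)$ is a bounded distributive lattice and for all $a,b\in A$: (K1) ${\sim}{\sim}a=a$; (K2) $a\le b$ iff ${\sim}b\le{\sim}a$; (K3) $a\wedge{\sim}a\le b\vee{\sim}b$. For $a,b$ in a lattice, the relative pseudocomplement $a\Rightarrow b$ is the greatest $x$ with $a\wedge x\le b$, if it exists. A quasi-Nelson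 algebra is a Kleene algebra in which, for every pair $a,b$ of elements, the relative pseudocomplement $a\Rightarrow({\sim}a\vee b)$ exists. *)

(* Defs.v *)
From HB Require Import structures.
From mathcomp Require Import all_boot all_order.
From mathcomp Require Import boolp classical_sets.

Set Implicit Arguments.
Unset Strict Implicit.
Unset Printing Implicit Defensive.

Import Order.TTheory.

Local Open Scope classical_set_scope.

Section RoughSets.
Context {U : Type}.
Implicit Types (R : set (U * U)) (X : set U) (H : set (set U)).

Definition tolerance R : Prop :=
  (forall x, R (x, x)) /\ (forall x y, R (x, y) -> R (y, x)).

Definition nbhd R (x : U) : set U := [set y | R (x, y)].

Definition lower R X : set U := [set x | nbhd R x `<=` X].
Definition upper R X : set U := [set x | nbhd R x `&` X !=set0].

Definition covering H : Prop :=
  (forall X, H X -> X !=set0) /\ \bigcup_(X in H) X = setT.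

Definition irredundant_covering H : Prop :=
  covering H /\ forall X, H X -> ~ covering (H `\ X).

Definition induced_tolerance H : set (U * U) := \bigcup_(X in H) (X `*` X).

(* [*p] is the product with the coordinatewise order; [set U] is ordered by
   inclusion. *)
Definition RS R : set (set U *p set U) :=
  [set (lower R X, upper R X) | X in setT].

Record rough R := Rough {
  rough_val : set U *p set U;
  _ : rough_val \in RS R
}.

HB.instance Definition _ R := [isSub for @rough_val R].
HB.instance Definition _ R := [Choice of rough R by <:].
HB.instance Definition _ R :=
  [SubChoice_isSubPOrder of rough R by <: with
    Order.prod_display set_display set_display].

Lemma rough_neg_subproof R (a : rough R) :
  ((~` (rough_val a).2, ~` (rough_val a).1) : set U *p set U) \in RS R.
Proof.
have := valP a; rewrite !inE => -[X _ <-]; exists (~` X) => //=.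
congr (_, _); apply/seteqP; split => x /=.
- by move=> RX [y [Ry Xy]]; exact: RX Ry Xy.
- by move=> nX y Ry Xy; apply: nX; exists y.
- by move=> [y [Ry nXy]] RX; exact/nXy/RX.
- by move=> /existsNP[y /not_implyP[Ry nXy]]; exists y.
Qed.

Definition rough_neg R (a : rough R) : rough R :=
  Rough (rough_neg_subproof a).

End RoughSets.

Local Open Scope order_scope.

Record is_kleene d (L : tbDistrLatticeType d) (neg : L -> L) : Prop := IsKleene {
  kleene_negK : forall a, neg (neg a) = a;
  kleene_leN2 : forall a b, (a <= b) = (neg b <= neg a);
  kleene_meetN_joinN : forall a b, Order.meet a (neg a) <= Order.join b (neg b)
}.

Definition is_rel_pseudocompl d (L : latticeType d) (a b c : L) : Prop :=
  Order.meet a c <= b /\ forall x, Order.meet a x <= b -> x <= c.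

Definition is_quasi_nelson d (L : tbDistrLatticeType d) (neg : L -> L) : Prop :=
  is_kleene neg /\
  forall a b, exists c, is_rel_pseudocompl a (Order.join (neg a) b) c.

(* Main.v *)
(** Choose in every block B of the irredundant covering a point d_B lying in no
    other block, so that R(d_B) = B, and let D be the set of these points. A
    rough set (A, B) is determined by its traces on D, the order is inclusion of
    traces, and the pairs (S, T) of subsets of D that occur are those such that
    every e in D whose block meets the block of some point of S lies in T, and
    S contains every point of T whose block is a singleton. Indeed such a pair
    is the trace of the rough set of the union of the blocks of S and of the
    points of T whose block misses that union. These two conditions are
    preserved by coordinatewise unions, so RS is a lattice of sets closed under
    arbitrary unions; hence all relative pseudocomplements exist. *)
Require Import Defs.
From HB Require Import structures.
From mathcomp Require Import all_boot all_order.
From mathcomp Require Import boolp classical_sets.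

Set Implicit Arguments.
Unset Strict Implicit.
Unset Printing Implicit Defensive.

Local Open Scope classical_set_scope.

(* In terms of the covering, [D] is a choice of one private point per block. *)
Record private_points {U : Type} (R : set (U * U)) (D : set U) : Prop :=
  PrivatePoints {
  private_refl : forall x, R (x, x);
  private_split : forall x y, R (x, y) ->
    exists2 e, D e & R (e, x) /\ R (e, y);
  private_clique : forall e x y, D e -> R (e, x) -> R (e, y) -> R (x, y);
  private_indep : forall e f, D e -> D f -> R (e, f) -> e = f
}.

(** A block without a private point could be deleted, since each of its points lies in another
    block; this contradicts irredundancy. *)
Lemma irredundant_private_points (U : Type) (R : set (U * U))
    (H : set (set U)) :
  tolerance R -> irredundant_covering H -> R = induced_tolerance H ->
  exists D, private_points R D.
Proof.
move=> [Rr _] [[Hn HU] Hirr] RH.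
have priv X : H X -> exists x, X x /\ forall Y, H Y -> Y x -> Y = X.
  move=> HX; apply: contrapT => nopriv; apply: (Hirr X HX); split.
    by move=> Y [HY _]; exact: Hn.
  apply/seteqP; split => // x _.
  have [Y HY Yx] : (\bigcup_(X in H) X) x by rewrite HU.
  have [YX|YX] := pselect (Y = X); last by exists Y.
  subst Y; apply: contrapT => nx; apply: nopriv; exists x; split => // Z HZ Zx.
  by apply: contrapT => ZX; apply: nx; exists Z.
(* The choice depends on the proof of [H X]; proof irrelevance leaves one point per block. *)
exists [set x | exists X (HX : H X), x = projT1 (cid (priv X HX))].
split=> //.
- move=> x y; rewrite {1}RH => -[X HX [Xx Xy]].
  exists (projT1 (cid (priv X HX))); first by exists X, HX.
  case: cid => d /= [Xd _]; rewrite RH.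
  by split; exists X.
- move=> _ x y [X [HX ->]]; case: cid => d /= [Xd dX].
  rewrite RH => -[Y HY [/= Yd Yx]] -[Z HZ [/= Zd Zy]].
  by exists X => //; split => /=; [rewrite -(dX Y)|rewrite -(dX Z)].
- move=> _ _ [X [HX ->]] [Y [HY ->]].
  rewrite RH => -[Z HZ [/=]].
  have [_ dX] := projT2 (cid (priv X HX)).
  have [_ dY] := projT2 (cid (priv Y HY)).
  move=> /(dX _ HZ) ZX /(dY _ HZ) ZY.
  by subst X Y; rewrite (Prop_irrelevance HX HY).
Qed.

Lemma rough_leP (U : Type) (R : set (U * U)) (a b : rough R) :
  (a <= b)%O <-> (rough_val a).1 `<=` (rough_val b).1 /\
                 (rough_val a).2 `<=` (rough_val b).2.
Proof.
change ((a <= b)%O) with ((rough_val a <= rough_val b)%O).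
rewrite Order.ProdOrder.leEprod -!subsetEset.
by split=> [/andP|h]; last exact/andP.
Qed.

(** * Traces of rough sets on the private points *)

Section Traces.
Context {U : Type} (R : set (U * U)) (D : set U) (hD : private_points R D).
Implicit Types (a b c : rough R) (X S T : set U) (F : set (rough R)).

(** [nbhd R x] is the union of the blocks [nbhd R e], [e] in [D], that contain [x], so inclusion in
    [X] is tested block by block. *)
Lemma lower_private X x :
  lower R X x <-> forall e, D e -> R (e, x) -> lower R X e.
Proof.
split=> [xX e De ex y ey|hx y xy].
  by apply: xX; exact: (private_clique hD De).
by have [e De [ex ey]] := private_split hD xy; exact: (hx e De ex y ey).
Qed.

Lemma upper_private X x :
  upper R X x <-> exists2 e, D e & R (e, x) /\ upper R X e.
Proof.
split=> [[y [xy Xy]]|[e De [ex [y [ey Xy]]]]].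
  by have [e De [ex ey]] := private_split hD xy; exists e => //; split=> //; exists y.
by exists y; split=> //; exact: (private_clique hD De).
Qed.

Lemma rough_le_trace a b :
  (forall e, D e -> ((rough_val a).1 e -> (rough_val b).1 e) /\
                    ((rough_val a).2 e -> (rough_val b).2 e)) <-> (a <= b)%O.
Proof.
split; last by move=> /rough_leP[h1 h2] e De; split; [exact: h1|exact: h2].
move=> h; apply/rough_leP.
case: a b h => [av aP] [bv bP] /=.
move: (aP) (bP); rewrite !inE => -[X _ <-] [Y _ <-] /= h; split=> x.
  move=> /lower_private hx; apply/lower_private => e De ex.
  by apply: (h e De).1; exact: hx.
move=> /upper_private[e De [ex hx]]; apply/upper_private.
by exists e => //; split=> //; exact: (h e De).2.
Qed.

(** The common point [x] lies in the represented set because the whole block of [e] does, so the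
    block of [f] meets that set. *)
Lemma trace_lower_upper a e f x :
  D e -> D f -> R (e, x) -> R (f, x) -> (rough_val a).1 e -> (rough_val a).2 f.
Proof.
case: a => av aP /=; move: (aP); rewrite inE => -[X _ <-] /= De Df ex fx eX.
by exists x; split=> //; exact: eX.
Qed.

Lemma trace_singleton a e : (forall y, R (e, y) -> y = e) ->
  (rough_val a).2 e -> (rough_val a).1 e.
Proof.
case: a => av aP /=; move: (aP); rewrite inE => -[X _ <-] /= e1 [y [ey Xy]] z.
by move=> /e1 ->; rewrite -(e1 y).
Qed.

Lemma rough_of_trace S T : S `<=` D -> T `<=` D ->
  (forall e f x, S e -> D f -> R (e, x) -> R (f, x) -> T f) ->
  (forall e, T e -> (forall y, R (e, y) -> y = e) -> S e) ->
  exists a, forall e, D e ->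
    ((rough_val a).1 e <-> S e) /\ ((rough_val a).2 e <-> T e).
Proof.
move=> SD TD ST TS.
pose V := [set x | exists2 e, S e & R (e, x)].
pose X := V `|` [set e | T e /\ forall x, R (e, x) -> ~ V x].
have XP : (lower R X, upper R X) \in RS R by rewrite inE; exists X.
exists (Rough XP) => e De /=; split; split.
- have VS : V e -> S e.
    by move=> [f Sf fe]; rewrite -(private_indep hD (SD _ Sf) De fe).
  move=> eX; case: (eX e (private_refl hD e)) => [//|[Te nV]].
  apply: TS => // y ey; case: (eX y ey) => [/(nV y ey)//|[Ty _]].
  by rewrite (private_indep hD De (TD _ Ty) ey).
- by move=> Se x ex; left; exists e.
- move=> [x [ex [[f Sf fx]|[Tx _]]]]; first exact: (ST f e x).
  by rewrite (private_indep hD De (TD _ Tx) ex).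
- move=> Te.
  have [[x [ex Vx]]|nV] := pselect (exists x, R (e, x) /\ V x).
    by exists x; split=> //; left.
  exists e; split; first exact: (private_refl hD).
  by right; split=> // x ex Vx; apply: nV; exists x.
Qed.

(** Both conditions on traces survive arbitrary unions. *)
Lemma rough_sup F : exists a, forall e, D e ->
  ((rough_val a).1 e <-> exists2 b, F b & (rough_val b).1 e) /\
  ((rough_val a).2 e <-> exists2 b, F b & (rough_val b).2 e).
Proof.
have [||||a aP] := @rough_of_trace
  (D `&` [set e | exists2 b, F b & (rough_val b).1 e])
  (D `&` [set e | exists2 b, F b & (rough_val b).2 e]).
- by move=> e [].
- by move=> e [].
- move=> e f x [De [b Fb be]] Df ex fx; split=> //; exists b => //.
  exact: (trace_lower_upper De Df ex fx).
- move=> e [De [b Fb be]] e1; split=> //; exists b => //.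
  exact: trace_singleton.
exists a => e De; have [a1 a2] := aP e De.
by split; [rewrite a1|rewrite a2]; split=> [[]|//].
Qed.

(** * Lattice operations and their laws *)

Definition rough_join a b : rough R := projT1 (cid (rough_sup [set a; b])).

(** De Morgan dual of the join: negation complements and swaps traces, so unions become
    intersections. *)
Definition rough_meet a b : rough R :=
  rough_neg (rough_join (rough_neg a) (rough_neg b)).

Lemma rough_joinE a b e : D e ->
  ((rough_val (rough_join a b)).1 e <->
     (rough_val a).1 e \/ (rough_val b).1 e) /\
  ((rough_val (rough_join a b)).2 e <->
     (rough_val a).2 e \/ (rough_val b).2 e).
Proof.
move=> De; rewrite /rough_join; case: cid => c /= /(_ e De)[-> ->].
have aF : [set a; b] a by left.
have bF : [set a; b] b by right.
split; (split=> [[_ [->|->] ce]|[ce|ce]];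
  [by left|by right|by exists a|by exists b]).
Qed.

Lemma rough_meetE a b e : D e ->
  ((rough_val (rough_meet a b)).1 e <->
     (rough_val a).1 e /\ (rough_val b).1 e) /\
  ((rough_val (rough_meet a b)).2 e <->
     (rough_val a).2 e /\ (rough_val b).2 e).
Proof.
move=> De; have [/= j1 j2] := rough_joinE (rough_neg a) (rough_neg b) De.
move: j1 j2; rewrite /= /setC /= => j1 j2; by rewrite j1 j2 !not_orE !notK.
Qed.

Lemma rough_bottom_subproof : ((set0, set0) : set U *p set U) \in RS R.
Proof.
rewrite inE; exists set0 => //; congr (_, _); apply/seteqP; split=> x //=.
  by move=> /(_ x (private_refl hD x)).
by move=> [y []].
Qed.

Definition rough_bottom : rough R := Rough rough_bottom_subproof.

Lemma rough_meetP a b c : (a <= rough_meet b c)%O = (a <= b)%O && (a <= c)%O.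
Proof.
apply/idP/andP.
  move=> /rough_le_trace h; split; apply/rough_le_trace => e De;
    have [] := h e De; have [m1 m2] := rough_meetE b c De; tauto.
move=> [/rough_le_trace hb /rough_le_trace hc]; apply/rough_le_trace => e De.
have [] := hb e De; have [] := hc e De.
by have [m1 m2] := rough_meetE b c De; tauto.
Qed.

Lemma rough_joinP a b c : (rough_join a b <= c)%O = (a <= c)%O && (b <= c)%O.
Proof.
apply/idP/andP.
  move=> /rough_le_trace h; split; apply/rough_le_trace => e De;
    have [] := h e De; have [j1 j2] := rough_joinE a b De; tauto.
move=> [/rough_le_trace ha /rough_le_trace hb]; apply/rough_le_trace => e De.
have [] := ha e De; have [] := hb e De.
by have [j1 j2] := rough_joinE a b De; tauto.
Qed.

Lemma rough_meetUl : left_distributive rough_meet rough_join.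
Proof.
move=> a b c; apply/eqP; rewrite Order.POrderTheory.eq_le.
by apply/andP; split; apply/rough_le_trace => e De;
  have [m1 m2] := rough_meetE (rough_join a b) c De;
  have [j1 j2] := rough_joinE a b De;
  have [k1 k2] := rough_joinE (rough_meet a c) (rough_meet b c) De;
  have [n1 n2] := rough_meetE a c De; have [p1 p2] := rough_meetE b c De; tauto.
Qed.

Lemma rough_bottom_le a : (rough_bottom <= a)%O.
Proof. by apply/rough_leP; split=> x. Qed.

Lemma rough_le_top a : (a <= rough_neg rough_bottom)%O.
Proof. by apply/rough_leP; split=> x _ []. Qed.

(** The join of all admissible [x] is itself admissible, because intersection distributes over
    arbitrary unions of traces. *)
Lemma rough_rel_pseudocompl a b : exists c, (rough_meet a c <= b)%O /\
  forall x, (rough_meet a x <= b)%O -> (x <= c)%O.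
Proof.
have [c cP] := rough_sup [set x | (rough_meet a x <= b)%O]; exists c; split.
  apply/rough_le_trace => e De; have [m1 m2] := rough_meetE a c De.
  have [c1 c2] := cP e De; rewrite m1 m2 c1 c2.
  by split=> -[ae [x /= /rough_le_trace/(_ e De)[h1 h2] xe]];
    have [n1 n2] := rough_meetE a x De; tauto.
move=> x xP; apply/rough_le_trace => e De; have [-> ->] := cP e De.
by split=> xe; exists x.
Qed.

Lemma rough_negK a : rough_neg (rough_neg a) = a.
Proof. by apply: val_inj; rewrite /= !setCK; case: (rough_val a). Qed.

Lemma rough_leN2 a b : (a <= b)%O = (rough_neg b <= rough_neg a)%O.
Proof.
by apply/idP/idP => /rough_leP[/= h1 h2]; apply/rough_leP => /=;
  rewrite ?setCS in h1 h2 *.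
Qed.

(** Lower traces lie in upper traces, so on [D] the first component on the left is empty and the
    second on the right is everything. *)
Lemma rough_meetN_joinN a b :
  (rough_meet a (rough_neg a) <= rough_join b (rough_neg b))%O.
Proof.
apply/rough_le_trace => e De.
have [m1 m2] := rough_meetE a (rough_neg a) De.
have [j1 j2] := rough_joinE b (rough_neg b) De.
have ale := trace_lower_upper (a := a) De De (private_refl hD e) (private_refl hD e).
have ble := trace_lower_upper (a := b) De De (private_refl hD e) (private_refl hD e).
rewrite m1 m2 j1 j2 /= /setC /=; split; first tauto.
by have [] := pselect ((rough_val b).1 e); tauto.
Qed.

End Traces.

(* The lattice structure depends on the existence of private points, so it is
   attached to an alias of [rough R] that records a proof of it. *)
Definition rough_lattice (U : Type) (R : set (U * U)) (D : set U)
  (_ : private_points R D) : Type := rough R.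

Section Instances.
Context {U : Type} (R : set (U * U)) (D : set U) (hD : private_points R D).

HB.instance Definition _ := Order.POrder.on (rough_lattice hD).
HB.instance Definition _ :=
  @Order.POrder_MeetJoin_isLattice.Build _ (rough_lattice hD)
    (rough_meet hD) (rough_join hD) (rough_meetP hD) (rough_joinP hD).
HB.instance Definition _ :=
  @Order.Lattice_Meet_isDistrLattice.Build _ (rough_lattice hD)
    (rough_meetUl hD).
HB.instance Definition _ :=
  @Order.hasBottom.Build _ (rough_lattice hD)
    (rough_bottom hD) (rough_bottom_le hD).
HB.instance Definition _ :=
  @Order.hasTop.Build _ (rough_lattice hD)
    (rough_neg (rough_bottom hD)) (rough_le_top hD).

End Instances.

(* A bounded distributive lattice structure on [rough R] is a class [c];
   [Order.TBDistrLattice.Pack c] is the corresponding lattice, whose carrier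
   is [rough R] by conversion. *)
Theorem proposition4p10 (U : Type) (R : set (U * U)) (H : set (set U)) :
  tolerance R -> irredundant_covering H -> R = induced_tolerance H ->
  exists (d : Order.disp_t) (c : Order.TBDistrLattice.axioms_ d (rough R)),
    let L : tbDistrLatticeType d := Order.TBDistrLattice.Pack c in
    [/\ forall a b : rough R,
          supremums [set a; b] (@Order.join d L a b : rough R),
        forall a b : rough R,
          infimums [set a; b] (@Order.meet d L a b : rough R),
        rough_val (@Order.bottom d L : rough R) = (set0, set0),
        rough_val (@Order.top d L : rough R) = (setT, setT)
      & @is_quasi_nelson d L (@rough_neg U R)].
Proof.
move=> tolR irrH RH; have [D hD] := irredundant_private_points tolR irrH RH.
exists _, (Order.TBDistrLattice.class (rough_lattice hD)) => L; split.
- move=> a b; split.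
    by move=> x [->|->]; have := Order.POrderTheory.le_refl (rough_join hD a b);
      rewrite [in X in X -> _]rough_joinP => /andP[].
  move=> c hc; change (rough_join hD a b <= c)%O; rewrite rough_joinP.
  by apply/andP; split; apply: hc; [left|right].
- move=> a b; split.
    by move=> x [->|->]; have := Order.POrderTheory.le_refl (rough_meet hD a b);
      rewrite [in X in X -> _]rough_meetP => /andP[].
  move=> c hc; change (c <= rough_meet hD a b)%O; rewrite rough_meetP.
  by apply/andP; split; apply: hc; [left|right].
- by [].
- by change ((~` (set0 : set U), ~` (set0 : set U)) = (setT, setT));
    rewrite setC0.
(* Relative pseudocomplements exist for all pairs, in particular for those of a quasi-Nelson
   algebra. *)
- split; last by move=> a b; exact: (rough_rel_pseudocompl hD).
  split; [exact: rough_negK|exact: rough_leN2|exact: (rough_meetN_joinN hD)].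
Qed.
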